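(* Let $n\in\mathbb{P}$, $n\ge 3$, and $i\in[0,n-1]$. Then \[\sum_{\sigma\in D_n^{\{i\}}}(-1)^{\ell(\sigma)}x^{L(\sigma)}=(1-x^2)\prod_{j=4}^{n}\left(1+(-1)^{j-1}x^{\lfloor j/2\rfloor}\right)^2.\]
   Context: $\mathbb{P}=\{1,2,\dots\}$, $[m,n]=\{m,\dots,n\}$, $[n]=[1,n]$. $B_n$ is the group of bijections $\sigma$ of $[-n,n]$ with $\sigma(-j)=-\sigma(j)$, written in window notation $[\sigma(1),\dots,\sigma(n)]$; $D_n$ is the subgroup of those with an even number of negative entries among $\sigma(1),\dots,\sigma(n)$. For $\sigma\in D_n$: $\ell(\sigma)=\mathrm{inv}(\sigma)+\mathrm{nsp}(\sigma)$, where $\mathrm{inv}(\sigma)=|\{(i,j)\in[n]^2:i<j,\sigma(i)>\sigma(j)\}|$ and $\mathrm{nsp}(\sigma)=|\{(i,j)\in[n]^2:i<j,\sigma(i)+\sigma(j)<0\}|$; $L(\sigma)=\mathrm{oinv}(\sigma)+\mathrm{onsp}(\sigma)$, where $\mathrm{oinv}(\sigma)=|\{(i,j)\in[n]^2:i<j,\sigma(i)>\sigma(j),i\not\equiv j\pmod 2\}|$ and $\mathrm{onsp}(\sigma)=|\{(i,j)\in[n]^2:\sigma(i)+\sigma(j)<0,i\not\equiv j\pmod 2\}|$. For $J\subseteq[0,n-1]$, $D_n^J=\{\sigma\in D_n:\sigma(j)<\sigma(j+1)\ \forall j\in J\}$ with the convention $\sigma(0):=-\sigma(2)$.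
   Formalization: In the definition of onsp the pairs (i,j) are restricted to i<j, as in inv, nsp and oinv; with all ordered pairs, as literally written, the identity fails (for n=3, i=1 the sum is 1−x^4 instead of 1−x^2). *)

(* Defs.v *)
From HB Require Import structures.
From mathcomp Require Import all_boot all_order all_algebra all_fingroup.

Set Implicit Arguments.
Unset Strict Implicit.
Unset Printing Implicit Defensive.

Import Order.TTheory GRing.Theory Num.Theory.

Local Open Scope ring_scope.

(* The interval [-n, n] of integers is encoded by 'I_(n.*2.+1), the ordinal k *)
(* standing for k - n; negation is then rev_ord (lemma centeredN).            *)
Definition centered (n : nat) (k : 'I_(n.*2.+1)) : int := k%:Z - n%:Z.

Lemma centeredN (n : nat) (k : 'I_(n.*2.+1)) :
  centered (rev_ord k) = - centered k.
Proof.
have : (k <= n.*2)%N by rewrite -ltnS.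
rewrite /centered /= subSS; move: (nat_of_ord k) => m lem.
by rewrite -subzn // -addnn PoszD opprB addrAC addrK.
Qed.

Definition Bgroup (n : nat) : {set {perm 'I_(n.*2.+1)}} :=
  [set s : {perm 'I_(n.*2.+1)} | [forall k, s (rev_ord k) == rev_ord (s k)]].

(* The integer s(j), for j in [0, n]. *)
Definition sval_at (n : nat) (s : {perm 'I_(n.*2.+1)}) (j : nat) : int :=
  centered (s (inord (n + j))).

Lemma centered_inord (n j : nat) :
  (j <= n)%N -> centered (inord (n + j) : 'I_(n.*2.+1)) = j%:Z.
Proof.
move=> lejn; rewrite /centered inordK; last first.
  by rewrite ltnS -addnn leq_add2l.
by rewrite PoszD addrAC subrr add0r.
Qed.

(* From here on an ordinal i : 'I_n used as a position stands for i.+1, so    *)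
(* that 'I_n enumerates [n] = {1, ..., n}.                                    *)
Definition window (n : nat) (s : {perm 'I_(n.*2.+1)}) (i : 'I_n) : int :=
  sval_at s i.+1.

Definition Dgroup (n : nat) : {set {perm 'I_(n.*2.+1)}} :=
  [set s in Bgroup n | ~~ odd #|[set i : 'I_n | window s i < 0]|].

Definition inv (n : nat) (s : {perm 'I_(n.*2.+1)}) : nat :=
  #|[set p : 'I_n * 'I_n |
      (p.1 < p.2)%N && (window s p.1 > window s p.2)]|.

Definition nsp (n : nat) (s : {perm 'I_(n.*2.+1)}) : nat :=
  #|[set p : 'I_n * 'I_n |
      (p.1 < p.2)%N && (window s p.1 + window s p.2 < 0)]|.

Definition ell (n : nat) (s : {perm 'I_(n.*2.+1)}) : nat :=
  (inv s + nsp s)%N.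

Definition oinv (n : nat) (s : {perm 'I_(n.*2.+1)}) : nat :=
  #|[set p : 'I_n * 'I_n |
      [&& (p.1 < p.2)%N, window s p.1 > window s p.2
        & (p.1.+1 != p.2.+1 %[mod 2])%N]]|.

(* As for nsp, each pair of positions is counted once (p.1 < p.2): the        *)
(* condition is symmetric, and counting ordered pairs would double onsp.      *)
Definition onsp (n : nat) (s : {perm 'I_(n.*2.+1)}) : nat :=
  #|[set p : 'I_n * 'I_n |
      [&& (p.1 < p.2)%N, window s p.1 + window s p.2 < 0
        & (p.1.+1 != p.2.+1 %[mod 2])%N]]|.

Definition oddlen (n : nat) (s : {perm 'I_(n.*2.+1)}) : nat :=
  (oinv s + onsp s)%N.

(* s(j) for j in [0, n] with the type D convention s(0) := - s(2), which      *)
(* overrides the value 0 that s takes at 0 as a bijection of [-n, n].         *)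
Definition sval_D (n : nat) (s : {perm 'I_(n.*2.+1)}) (j : nat) : int :=
  if j == 0%N then - sval_at s 2 else sval_at s j.

(* Here J ranges over subsets of [0, n - 1]: j : 'I_n stands for j itself. *)
Definition Dquotient (n : nat) (J : {set 'I_n}) : {set {perm 'I_(n.*2.+1)}} :=
  [set s in Dgroup n | [forall j in J, sval_D s j < sval_D s j.+1]].

(* Main.v *)
Require Import Defs.
From HB Require Import structures.
From mathcomp Require Import all_boot all_order all_algebra all_fingroup.
From mathcomp Require Import zify ring.

Set Implicit Arguments.
Unset Strict Implicit.
Unset Printing Implicit Defensive.

Import Order.TTheory GRing.Theory Num.Theory.

Local Open Scope ring_scope.

(* Signed permutations are read as words whose letters are coloured by the    *)
(* parity of their position; L counts the inversions and the negative sums of *)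
(* pairs of letters of different colours.                                     *)
(*   Flipping the sign of the letter +-1 changes neither ell nor L nor the    *)
(* ascent conditions, but it exchanges D_n with its complement in B_n, so the *)
(* sum over D_n is half of the sum over B_n. Negating the first letter        *)
(* exchanges inversions and negative sums of the pairs containing it, and     *)
(* reduces the case i = 0 to i = 1.                                           *)
(*   Exchanging the letters at positions p and p + 2 pairs off the words, and *)
(* the contribution of each pair to the full sum is 1 - x^2 times its         *)
(* contribution to the sum over words with an ascent at p (or at p + 1). So   *)
(* the ascent sum times 1 - x^2 is the full sum over B_n.                     *)
(*   The full sum vanishes for any colouring with two equal neighbours, by    *)
(* exchanging these two letters. Removing the letter of largest absolute      *)
(* value from an alternating colouring creates such neighbours unless the     *)
(* letter stands at one of the ends, which yields a recursion with the factor *)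
(* 1 + x^(2m) + 2 (-1)^(n-1) x^m = (1 + (-1)^(n-1) x^m)^2, m = floor(n/2).    *)

Section SumInvolution.

Variables (T : eqType) (V : nmodType) (s : seq T) (theta : T -> T).
Hypothesis s_uniq : uniq s.
Hypothesis theta_stable : {in s, forall w, theta w \in s}.
Hypothesis thetaK : {in s, cancel theta theta}.

Lemma perm_map_involution : perm_eq (map theta s) s.
Proof.
apply: uniq_perm => //.
  by rewrite map_inj_in_uniq //; apply: can_in_inj thetaK.
move=> w; apply/mapP/idP => [[v vs ->] | ws]; first exact: theta_stable.
by exists (theta w); rewrite ?theta_stable ?thetaK.
Qed.

Lemma reindex_sum_involution (P : pred T) (F : T -> V) :
  \sum_(w <- s | P w) F w = \sum_(w <- s | P (theta w)) F (theta w).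
Proof. by rewrite -(perm_big _ perm_map_involution) big_map. Qed.

Lemma pair_sum_involution (P : pred T) (F : T -> V) :
    {in s, forall w, P (theta w) = ~~ P w} ->
  \sum_(w <- s) F w = \sum_(w <- s | P w) (F w + F (theta w)).
Proof.
move=> P_theta; rewrite [LHS](bigID P) big_split /=; congr (_ + _).
rewrite reindex_sum_involution [LHS]big_seq_cond [RHS]big_seq_cond.
apply: eq_bigl => w; apply: andb_id2l => /P_theta ->.
by rewrite negbK.
Qed.

End SumInvolution.

Section Blocks.

Variable T : Type.
Implicit Types (w u v t : seq T) (p k : nat).

Definition block p k w := take k (drop p w).

Definition rev_block p k w :=
  take p w ++ rev (block p k w) ++ drop (p + k) w.

Lemma cat_block p k w : take p w ++ block p k w ++ drop (p + k) w = w.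
Proof. by rewrite /block addnC -drop_drop !cat_take_drop. Qed.

Lemma size_block p k w : (p + k <= size w)%N -> size (block p k w) = k.
Proof. by move=> le_pk; rewrite size_takel // size_drop; lia. Qed.

Lemma nth_block x0 p k w j :
  (j < k)%N -> nth x0 (block p k w) j = nth x0 w (p + j).
Proof. by move=> lt_jk; rewrite nth_take // nth_drop. Qed.

Lemma block_map_nth x0 p k w : (p + k <= size w)%N ->
  block p k w = [seq nth x0 w i | i <- iota p k].
Proof. by move=> le_pk; rewrite map_nth_iota //; lia. Qed.

Lemma block_rev_block p k w :
  (p + k <= size w)%N -> block p k (rev_block p k w) = rev (block p k w).
Proof.
move=> le_pk; rewrite {1}/block /rev_block drop_size_cat ?size_takel //.
  by rewrite take_size_cat // size_rev size_block.
by lia.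
Qed.

Lemma rev_blockK p k w :
  (p + k <= size w)%N -> rev_block p k (rev_block p k w) = w.
Proof.
move=> le_pk; have szp : size (take p w) = p by rewrite size_takel //; lia.
rewrite {1}/rev_block block_rev_block // revK -[RHS](cat_block p k).
rewrite /rev_block take_size_cat // [X in drop _ X]catA drop_size_cat //.
by rewrite size_cat szp size_rev size_block.
Qed.

Lemma nth_rev_block x0 p k w j : (p + k <= size w)%N -> (j < k)%N ->
  nth x0 (rev_block p k w) (p + j) = nth x0 w (p + (k - j.+1)).
Proof.
move=> le_pk lt_jk; rewrite -(nth_block _ _ _ lt_jk) block_rev_block //.
by rewrite nth_rev size_block // nth_block //; lia.
Qed.

Definition insert_at p y w := take p w ++ y :: drop p w.

Definition delete_at p w := take p w ++ drop p.+1 w.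

Lemma size_delete_at p w : (p < size w)%N -> size (delete_at p w) = (size w).-1.
Proof. by move=> lt_pw; rewrite size_cat size_takel ?size_drop; lia. Qed.

Lemma nth_delete_at x0 p w i : (p < size w)%N ->
  nth x0 (delete_at p w) i = nth x0 w (bump p i).
Proof.
move=> lt_pw; rewrite nth_cat size_takel ?(ltnW lt_pw) // /bump.
case: (ltnP i p) => lt_ip; first by rewrite nth_take.
by rewrite nth_drop; congr nth; lia.
Qed.

End Blocks.

Lemma perm_rev_block (T : eqType) p k (w : seq T) :
  perm_eq (rev_block p k w) w.
Proof.
by rewrite -{2}(cat_block p k w) perm_cat2l perm_cat2r perm_rev.
Qed.

Lemma perm_insert_at (T : eqType) p (y : T) w :
  perm_eq (insert_at p y w) (y :: w).
Proof. by rewrite perm_catC /= perm_cons perm_catC cat_take_drop. Qed.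

Lemma insert_at_inj (T : eqType) (a : pred T) p q y z (v w : seq T) :
    (p <= size v)%N -> (q <= size w)%N -> a y -> a z ->
    ~~ has a v -> ~~ has a w ->
  insert_at p y v = insert_at q z w -> [/\ p = q, y = z & v = w].
Proof.
have find_insert r b u :
    (r <= size u)%N -> a b -> ~~ has a u -> find a (insert_at r b u) = r.
  move=> le_ru ab; rewrite -{1}(cat_take_drop r u) has_cat negb_or.
  move=> /andP[au _].
  by rewrite find_cat (negPf au) /= ab addn0 size_takel.
move=> le_pv le_qw ay az av aw eq_ins.
have eq_pq : p = q.
  by rewrite -(find_insert p y v) // eq_ins find_insert.
rewrite -{q}eq_pq in le_qw eq_ins *; split=> //.
  move/eqP: eq_ins; rewrite eqseq_cat ?size_takel // => /andP[_ /eqP[]] //.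
move/eqP: eq_ins; rewrite eqseq_cat ?size_takel // => /andP[/eqP eq_take].
move=> /eqP[_ eq_drop].
by rewrite -(cat_take_drop p v) eq_take eq_drop cat_take_drop.
Qed.

(** * Signed words *)

(* The ways to insert the letter n or -n into a word of length n - 1. *)
Definition placements n : seq (nat * int) :=
  [seq (p, y) | p <- iota 0 n, y <- [:: n%:Z; - n%:Z]].

Fixpoint signed_words n : seq (seq int) :=
  if n is m.+1 then
    [seq insert_at py.1 py.2 w | py <- placements n, w <- signed_words m]
  else [:: [::]].

Arguments placements : simpl never.
Arguments signed_words : simpl never.

Lemma signed_wordsS n :
  signed_words n.+1
  = [seq insert_at py.1 py.2 w | py <- placements n.+1, w <- signed_words n].
Proof. by []. Qed.

Lemma mem_placements n p y :
  ((p, y) \in placements n) = (p < n)%N && (absz y == n).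
Proof.
apply/allpairsP/idP => [[-[q z] /= [q_in z_in [-> ->]]] | py_ok].
  by move: q_in z_in; rewrite mem_iota !inE; lia.
by exists (p, y); rewrite /= mem_iota !inE; split=> //; lia.
Qed.

Lemma mem_signed_words n w :
  (w \in signed_words n) = perm_eq (map absz w) (iota 1 n).
Proof.
elim: n w => [|n IH] w.
  by rewrite inE; apply/eqP/idP => [-> // | /perm_nilP]; case: w.
have perm_insert p y v : absz y = n.+1 ->
    perm_eq (map absz (insert_at p y v)) (iota 1 n.+1) = (v \in signed_words n).
  move=> abs_y; rewrite (permPl (perm_map absz (perm_insert_at p y v))) /=.
  rewrite abs_y -/(iota 1 n.+1) -(addn1 n) iotaD perm_sym perm_catC /=.
  by rewrite add1n addn1 perm_cons perm_sym IH.
apply/allpairsP/idP => [[[[p y] v] [/= py_in v_in ->]] | perm_w].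
  by move: py_in; rewrite mem_placements => /andP[_ /eqP /perm_insert ->].
have /mapP[y yw abs_y] : n.+1 \in map absz w.
  by rewrite (perm_mem perm_w) mem_iota; lia.
case/splitPr: yw => u v in perm_w *; exists ((size u, y), u ++ v).
have uv_insert : u ++ y :: v = insert_at (size u) y (u ++ v).
  by rewrite /insert_at take_size_cat // drop_size_cat.
rewrite /= uv_insert -(perm_insert (size u) y) -?uv_insert //.
rewrite mem_placements -abs_y eqxx; split=> //; move/perm_size: perm_w.
by rewrite size_map size_iota size_cat /= => <-; lia.
Qed.

Lemma size_signed_word n w : w \in signed_words n -> size w = n.
Proof.
by rewrite mem_signed_words => /perm_size; rewrite size_map size_iota.
Qed.

Lemma signed_word_absz_bounds n w y :
  w \in signed_words n -> y \in w -> (0 < absz y <= n)%N.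
Proof.
rewrite mem_signed_words => /perm_mem absw /(map_f absz).
by rewrite absw mem_iota; lia.
Qed.

Lemma uniq_absz_signed_word n w : w \in signed_words n -> uniq (map absz w).
Proof.
by rewrite mem_signed_words => /perm_uniq ->; rewrite iota_uniq.
Qed.

Lemma eq_absz_nth_signed_word n w i j :
    w \in signed_words n -> (i < n)%N -> (j < n)%N ->
  (absz (nth 0 w i) == absz (nth 0 w j)) = (i == j).
Proof.
move=> w_in lt_in lt_jn; have szw := size_signed_word w_in.
rewrite -!(nth_map _ 0%N) ?szw // nth_uniq ?size_map ?szw //.
exact: uniq_absz_signed_word w_in.
Qed.

Lemma eq_nth_signed_word n w i j :
    w \in signed_words n -> (i < n)%N -> (j < n)%N ->
  (nth 0 w i == nth 0 w j) = (i == j).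
Proof.
move=> w_in lt_in lt_jn; apply/eqP/eqP => [eq_w | -> //].
by apply/eqP; rewrite -(eq_absz_nth_signed_word w_in) // eq_w.
Qed.

Lemma uniq_signed_words n : uniq (signed_words n).
Proof.
elim: n => // n IH; rewrite signed_wordsS; apply: allpairs_uniq => //.
  apply: allpairs_uniq => //; first exact: iota_uniq.
  by move=> [? ?] [? ?].
pose is_max (y : int) := absz y == n.+1.
have no_max v : v \in signed_words n -> ~~ has is_max v.
  move=> v_in; apply/hasPn => y /(signed_word_absz_bounds v_in).
  by rewrite /is_max; lia.
move=> [[p y] v] [[q z] w] /allpairsP[[[p' y'] v'] [py_in v_in [-> -> ->]]].
move=> /allpairsP[[[q' z'] w'] [qz_in w_in [-> -> ->]]] /=.
move: py_in qz_in; rewrite /= !mem_placements.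
move=> /andP[lt_p max_y] /andP[lt_q max_z] /(insert_at_inj (a := is_max)).
case=> //; rewrite ?(size_signed_word v_in) ?(size_signed_word w_in) ?no_max //.
by move=> -> -> ->.
Qed.

Lemma perm_signed_words n v w :
  perm_eq v w -> (v \in signed_words n) = (w \in signed_words n).
Proof.
by move=> pvw; rewrite !mem_signed_words (permPl (perm_map absz pvw)).
Qed.

Lemma sum_signed_words_rev_block (V : nmodType) n p k (F : seq int -> V) :
    (1 < k)%N -> (p + k <= n)%N ->
  \sum_(w <- signed_words n) F w
  = \sum_(w <- signed_words n | nth 0 w p < nth 0 w (p + k.-1))
      (F w + F (rev_block p k w)).
Proof.
move=> lt1k le_pk; apply: pair_sum_involution => [|w w_in|w w_in|w w_in].
- exact: uniq_signed_words.
- by rewrite (perm_signed_words _ (perm_rev_block p k w)).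
- by rewrite rev_blockK // (size_signed_word w_in).
have le_pkw : (p + k <= size w)%N by rewrite (size_signed_word w_in).
have [lt0k lt_k1] : (0 < k)%N /\ (k.-1 < k)%N by lia.
have := nth_rev_block 0 le_pkw lt_k1; have := nth_rev_block 0 le_pkw lt0k.
rewrite prednK // subnn subn1 !addn0 => -> ->; rewrite ltNge le_eqVlt.
by rewrite (eq_nth_signed_word w_in) //; lia.
Qed.

Definition alternating (b : bool) n : seq bool :=
  mkseq (fun k => b (+) odd k) n.

Lemma alternatingS b n :
  alternating b n.+1 = rcons (alternating b n) (b (+) odd n).
Proof. exact: mkseqS. Qed.

Lemma drop1_alternating b n :
  drop 1 (alternating b n.+1) = alternating (~~ b) n.
Proof.
rewrite /alternating /mkseq /= drop0 (iotaDl 1 0) -map_comp.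
by apply: eq_map => k /=; rewrite addNb addbN.
Qed.

Lemma take_alternating b n : take n (alternating b n.+1) = alternating b n.
Proof. by rewrite alternatingS -cats1 take_size_cat ?size_mkseq. Qed.

Lemma nth_delete_inner_alternating b n p : (p.+2 < n)%N ->
  let c := delete_at p.+1 (alternating b n) in nth false c p = nth false c p.+1.
Proof.
move=> lt_pn; rewrite /= !nth_delete_at ?size_mkseq; try lia.
by rewrite /bump ltnn leqnn !nth_mkseq /= ?negbK //; lia.
Qed.

Definition ascent p (w : seq int) := nth 0 w p < nth 0 w p.+1.

Lemma ascent_block p k w j :
  (j.+1 < k)%N -> ascent j (block p k w) = ascent (p + j) w.
Proof. by move=> lt_jk; rewrite /ascent !nth_block ?addnS // ltnW. Qed.

Definition D_ascent i (w : seq int) :=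
  if i is p.+1 then ascent p w else - nth 0 w 1 < nth 0 w 0.

Definition neg_head (w : seq int) := if w is y :: v then - y :: v else w.

Lemma neg_headK : involutive neg_head.
Proof. by case=> //= y w; rewrite opprK. Qed.

Lemma neg_head_signed_word n w :
  w \in signed_words n -> neg_head w \in signed_words n.
Proof. by case: w => // y w; rewrite !mem_signed_words /= abszN. Qed.

Lemma D_ascent_neg_head w :
  (1 < size w)%N -> D_ascent 0 (neg_head w) = ascent 0 w.
Proof. by case: w => [|y [|z w]] //= _; rewrite ltrN2. Qed.

(* What the weight of a pair and the ascent conditions know of two letters. *)
Definition comparisons (y z : int) : bool * bool := (z < y, y + z < 0).

Definition flip_unit (y : int) : int := if absz y == 1%N then - y else y.

Lemma absz_flip_unit y : absz (flip_unit y) = absz y.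
Proof. by rewrite /flip_unit; case: ifP; rewrite ?abszN. Qed.

Lemma flip_unitK : involutive flip_unit.
Proof.
move=> y; rewrite {1}/flip_unit absz_flip_unit /flip_unit.
by case: eqP; rewrite ?opprK.
Qed.

Lemma flip_unit_signed_word n w :
  w \in signed_words n -> map flip_unit w \in signed_words n.
Proof.
rewrite !mem_signed_words -map_comp.
rewrite (@eq_map _ _ (absz \o flip_unit) absz) // => y.
exact: absz_flip_unit.
Qed.

Lemma comparisons_flip_unit y z : y != 0 -> z != 0 -> absz y != absz z ->
  comparisons (flip_unit y) (flip_unit z) = comparisons y z.
Proof.
rewrite /comparisons /flip_unit => *.
by case: ifP => ?; case: ifP => ?; congr pair; lia.
Qed.

Lemma comparisons_nth_flip_unit n w i j :
    w \in signed_words n -> (i < n)%N -> (j < n)%N -> i != j ->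
  let v := map flip_unit w in
  comparisons (nth 0 v i) (nth 0 v j) = comparisons (nth 0 w i) (nth 0 w j).
Proof.
move=> w_in lt_in lt_jn neq_ij; have szw := size_signed_word w_in.
have nth_neq0 k : (k < n)%N -> nth 0 w k != 0.
  rewrite -szw -absz_gt0 => /(mem_nth 0) wk_in.
  by have /andP[] := signed_word_absz_bounds w_in wk_in.
rewrite /= !(nth_map 0) ?szw //.
apply: comparisons_flip_unit; rewrite ?nth_neq0 //.
by rewrite (eq_absz_nth_signed_word w_in).
Qed.

Lemma D_ascent_flip_unit n i w :
    (1 < n)%N -> (i < n)%N -> w \in signed_words n ->
  D_ascent i (map flip_unit w) = D_ascent i w.
Proof.
move=> lt1n lt_in w_in; case: i lt_in => [|p] lt_pn /=.
  have ltNE y z : absz y != absz z -> (- z < y) = ~~ (y + z < 0) by lia.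
  have [_ sum_neg] := comparisons_nth_flip_unit w_in (ltnW lt1n) lt1n isT.
  by rewrite !ltNE ?sum_neg ?(eq_absz_nth_signed_word _ lt_pn lt1n)
    ?flip_unit_signed_word.
have neq_p1p : p.+1 != p by rewrite gtn_eqF.
by have [] := comparisons_nth_flip_unit w_in lt_pn (ltnW lt_pn) neq_p1p.
Qed.

Definition negatives (w : seq int) := count (fun y : int => y < 0) w.

Lemma odd_negatives_flip_unit n w : (0 < n)%N -> w \in signed_words n ->
  odd (negatives (map flip_unit w)) = ~~ odd (negatives w).
Proof.
move=> n_gt0 w_in; have w_uniq := uniq_absz_signed_word w_in.
have /mapP[y yw abs_y] : 1%N \in map absz w.
  rewrite mem_signed_words in w_in.
  by rewrite (perm_mem w_in) mem_iota; lia.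
case/splitPr: yw => u v in w_uniq *.
move: w_uniq; rewrite map_cat cat_uniq /= -abs_y negb_or.
move=> /and3P[_ /andP[u_no1 _] /andP[v_no1 _]].
have flip_id t : 1%N \notin map absz t -> map flip_unit t = t.
  move=> t_no1; apply: map_id_in => z zt; rewrite /flip_unit ifF //.
  by apply: contraNF t_no1 => /eqP <-; apply: map_f.
rewrite /negatives map_cat /= !flip_id // !count_cat /= !oddD /flip_unit -abs_y.
have -> : (- y < 0) = ~~ (y < 0) by lia.
by case: (y < 0) => /=; do 2 case: odd.
Qed.

Lemma prod_zip_snd (R : pzSemiRingType) (S T : eqType) (w : seq S) (c : seq T)
    (f : S * T -> R) (g : T -> R) :
    size w = size c -> {in w, forall y d, f (y, d) = g d} ->
  \prod_(a <- zip w c) f a = \prod_(d <- c) g d.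
Proof.
move=> eq_sz fg; rewrite -[in RHS](@unzip2_zip _ _ w c) ?eq_sz // big_map.
apply: eq_big_seq => -[y d] /(map_f fst).
by rewrite -/(unzip1 _) unzip1_zip ?eq_sz // => /fg ->.
Qed.

(** * Weights of coloured words *)

Section ColoredWeights.

Variables (R : comPzRingType) (x : R).
Implicit Types (a b : int * bool) (u v t : seq (int * bool)).
Implicit Types (w : seq int) (c : seq bool).

Definition pair_factor (d : bool) : R := if d then - x else -1.

(* A coloured letter carries its value and the parity of its position; the    *)
(* weight is the contribution of the pair to (-1)^ell x^L when a stands       *)
(* before b.                                                                  *)
Definition pair_weight a b : R :=
  pair_factor (a.2 (+) b.2) ^+ ((b.1 < a.1)%R + (a.1 + b.1 < 0)%R).

Fixpoint weight u : R :=
  if u is a :: v then (\prod_(b <- v) pair_weight a b) * weight v else 1.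

Definition word_sum c : R :=
  \sum_(w <- signed_words (size c)) weight (zip w c).

Lemma weight_cat u v :
  weight (u ++ v)
  = weight u * (\prod_(a <- u) \prod_(b <- v) pair_weight a b) * weight v.
Proof.
elim: u => [|a u IH] /=; first by rewrite big_nil !mul1r.
rewrite IH big_cat big_cons /=; ring.
Qed.

Lemma weight_insert u v a :
  weight (u ++ a :: v)
  = (\prod_(b <- u) pair_weight b a) * (\prod_(b <- v) pair_weight a b)
    * weight (u ++ v).
Proof.
rewrite !weight_cat /=; under eq_bigr => b _ do rewrite big_cons.
rewrite big_split /=; ring.
Qed.

Lemma weight_perm_infix u v v' t : perm_eq v v' ->
  exists K, weight (u ++ v ++ t) = K * weight v
         /\ weight (u ++ v' ++ t) = K * weight v'.
Proof.
move=> pvv'.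
exists (weight u * (\prod_(a <- u) \prod_(b <- v ++ t) pair_weight a b)
        * (\prod_(a <- v) \prod_(b <- t) pair_weight a b) * weight t).
rewrite !weight_cat; split; first by ring.
rewrite -(perm_big _ pvv') /=.
under eq_bigr => a _ do rewrite (perm_big (v ++ t)) ?perm_cat2r 1?perm_sym //.
ring.
Qed.

Lemma weight_rev_block p k w c :
    size w = size c -> (p + k <= size c)%N ->
    rev (block p k c) = block p k c ->
  exists K, weight (zip w c) = K * weight (zip (block p k w) (block p k c))
         /\ weight (zip (rev_block p k w) c)
            = K * weight (zip (rev (block p k w)) (block p k c)).
Proof.
move=> eq_sz le_pk rev_c.
have szt : size (take p w) = size (take p c) by rewrite !size_take eq_sz.
have szb : size (block p k w) = size (block p k c).
  by rewrite !size_block ?eq_sz.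
have -> : zip w c = zip (take p w) (take p c)
    ++ zip (block p k w) (block p k c) ++ zip (drop (p + k) w) (drop (p + k) c).
  by rewrite -!zip_cat ?cat_block.
have -> : zip (rev_block p k w) c = zip (take p w) (take p c)
    ++ zip (rev (block p k w)) (block p k c)
    ++ zip (drop (p + k) w) (drop (p + k) c).
  by rewrite -!zip_cat ?size_rev ?cat_block.
by apply: weight_perm_infix; rewrite -{2}rev_c -rev_zip // perm_sym perm_rev.
Qed.

Lemma weight_zip w c : size w = size c ->
  weight (zip w c) = \prod_(i < size w) \prod_(j < size w | (i < j)%N)
    pair_weight (nth 0 w i, nth false c i) (nth 0 w j, nth false c j).
Proof.
elim: w c => [|y w IH] [|d c] //=; first by rewrite big_ord0.
move=> [eq_sz]; rewrite big_ord_recl; congr (_ * _).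
  rewrite [RHS]big_mkcond big_ord_recl /= mul1r (big_nth (0, false)) big_mkord.
  by rewrite size_zip -eq_sz minnn; apply: eq_bigr => i _; rewrite nth_zip.
rewrite IH //; apply: eq_bigr => i _.
by rewrite [RHS]big_mkcond big_ord_recl /= mul1r [LHS]big_mkcond.
Qed.

Lemma eq_weight w w' c : size w = size c -> size w' = size c ->
    (forall i j, (i < j < size c)%N ->
       comparisons (nth 0 w' i) (nth 0 w' j)
       = comparisons (nth 0 w i) (nth 0 w j)) ->
  weight (zip w' c) = weight (zip w c).
Proof.
move=> sw sw' eq_cmp; rewrite !weight_zip // sw sw'.
apply: eq_bigr => i _; apply: eq_bigr => j lt_ij; rewrite /pair_weight /=.
have lt_ijc : (i < j < size c)%N by rewrite lt_ij ltn_ord.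
by have [-> ->] := eq_cmp i j lt_ijc.
Qed.

Lemma weight_rev2_same_color y z d : y != z ->
  weight (zip [:: y; z] [:: d; d]) + weight (zip [:: z; y] [:: d; d]) = 0.
Proof.
rewrite /= !big_cons !big_nil /pair_weight /= addbb [z + y]addrC.
case: (ltgtP y z) => // _ _; rewrite !exprD !(expr0, expr1) /pair_factor; ring.
Qed.

(* If the middle letter does not lie between the outer ones, the weights of   *)
(* the two arrangements cancel, and both or none have the ascent.             *)
Lemma weight_rev3_alternating y m z d (j : bool) :
    uniq [:: y; m; z] -> y < z ->
  let W w := weight (zip w [:: d; ~~ d; d]) in
  (1 - x ^+ 2)
    * ((if ascent j [:: y; m; z] then W [:: y; m; z] else 0)
       + (if ascent j [:: z; m; y] then W [:: z; m; y] else 0))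
  = W [:: y; m; z] + W [:: z; m; y].
Proof.
rewrite /= !inE negb_or => /and3P[/andP[neq_ym _] neq_mz _] lt_yz.
rewrite !big_cons !big_nil /pair_weight /ascent /= addbb addbN addNb addbb /=.
rewrite [z + m]addrC [z + y]addrC [m + y]addrC lt_yz (lt_gtF lt_yz) !exprD.
move: (_ ^+ (y + m < 0)%R) (_ ^+ (y + z < 0)%R) (_ ^+ (m + z < 0)%R).
move=> sum_ym sum_yz sum_mz; case: j => /=;
  case: (ltgtP y m) neq_ym => // lt_ym _;
  case: (ltgtP m z) neq_mz => // lt_mz _;
  by [lia | rewrite !(expr0, expr1); ring].
Qed.

Lemma word_sum_adjacent_eq0 c p : (p.+1 < size c)%N ->
  nth false c p = nth false c p.+1 -> word_sum c = 0.
Proof.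
move=> lt_pc eq_c; have le_p2 : (p + 2 <= size c)%N by lia.
rewrite /word_sum (sum_signed_words_rev_block _ (ltnSn 1) le_p2).
apply: big1_seq => w /andP[lt_w w_in]; have sw := size_signed_word w_in.
have block_c : block p 2 c = [:: nth false c p; nth false c p].
  by rewrite (block_map_nth false) //= -eq_c.
have block_w : block p 2 w = [:: nth 0 w p; nth 0 w p.+1].
  by rewrite (block_map_nth 0) ?sw.
have [|K [-> ->]] := weight_rev_block sw le_p2; first by rewrite block_c.
rewrite block_c block_w -mulrDr weight_rev2_same_color ?mulr0 //.
by rewrite addn1 in lt_w; rewrite lt_eqF.
Qed.

Lemma sum_ascent_block3 c q (j : bool) : (q.+2 < size c)%N ->
    nth false c q.+1 = ~~ nth false c q -> nth false c q.+2 = nth false c q ->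
  (1 - x ^+ 2)
    * (\sum_(w <- signed_words (size c) | ascent (q + j) w) weight (zip w c))
  = word_sum c.
Proof.
move=> lt_qc c1 c2; have le_q3 : (q + 3 <= size c)%N by lia.
pose sum_rev := sum_signed_words_rev_block _ (isT : 1 < 3)%N le_q3.
rewrite /word_sum big_mkcond !sum_rev mulr_sumr.
rewrite big_seq_cond [RHS]big_seq_cond; apply: eq_bigr => w /andP[w_in lt_w].
have sw := size_signed_word w_in; set d := nth false c q in c1 c2.
have block_c : block q 3 c = [:: d; ~~ d; d].
  by rewrite (block_map_nth false) //= c1 c2.
have [|K [-> ->]] := weight_rev_block sw le_q3; first by rewrite block_c.
rewrite -!(@ascent_block q 3) ?block_rev_block ?sw //; try by case: (j).
have -> : block q 3 w = [:: nth 0 w q; nth 0 w q.+1; nth 0 w q.+2].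
  by rewrite (block_map_nth 0) ?sw.
rewrite block_c -[rev _]/[:: nth 0 w q.+2; nth 0 w q.+1; nth 0 w q] -mulrDr.
rewrite addn2 in lt_w; rewrite -(weight_rev3_alternating _ j) //; last first.
  by rewrite /= !inE !(eq_nth_signed_word w_in) //; lia.
by do 2 case: (ascent _ _); ring.
Qed.

Lemma pair_weight_max_left y z d e : (absz z < absz y)%N ->
  pair_weight (y, d) (z, e) = pair_factor (d (+) e).
Proof.
move=> lt_zy; rewrite /pair_weight /=.
have -> : (z < y) = ~~ (y + z < 0) by lia.
by case: (y + z < 0).
Qed.

Lemma pair_weight_max_right y z d e : (absz z < absz y)%N ->
  pair_weight (z, e) (y, d) = pair_factor (d (+) e) ^+ (y < 0)%R.*2.
Proof.
move=> lt_zy; rewrite /pair_weight /= addbC -addnn.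
by congr (_ ^+ (nat_of_bool _ + nat_of_bool _)); lia.
Qed.

Lemma weight_insert_max n p y w c :
    w \in signed_words n -> size c = n.+1 -> (p < n.+1)%N -> absz y = n.+1 ->
  let d := nth false c p in
  weight (zip (insert_at p y w) c)
  = (\prod_(e <- drop p.+1 c) pair_factor (d (+) e))
    * (\prod_(e <- take p c) pair_factor (d (+) e) ^+ (y < 0)%R.*2)
    * weight (zip w (delete_at p c)).
Proof.
move=> w_in szc lt_pn abs_y d; have szw := size_signed_word w_in.
have lt_y z : z \in w -> (absz z < absz y)%N.
  by rewrite abs_y ltnS => /(signed_word_absz_bounds w_in)/andP[].
have sz_take : size (take p w) = size (take p c).
  by rewrite !size_takel ?szw ?szc // ltnW.
have sz_drop : size (drop p w) = size (drop p.+1 c).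
  by rewrite !size_drop szw szc subSS.
have -> : zip (insert_at p y w) c = zip (take p w) (take p c)
    ++ (y, d) :: zip (drop p w) (drop p.+1 c).
  by rewrite -[in LHS](cat_take_drop p c) zip_cat // (drop_nth false) ?szc.
have -> : zip w (delete_at p c) = zip (take p w) (take p c)
    ++ zip (drop p w) (drop p.+1 c).
  by rewrite -zip_cat // cat_take_drop.
have prod_after : \prod_(a <- zip (drop p w) (drop p.+1 c)) pair_weight (y, d) a
    = \prod_(e <- drop p.+1 c) pair_factor (d (+) e).
  apply: prod_zip_snd => // z /mem_drop /lt_y lt_zy e.
  exact: pair_weight_max_left.
have prod_before : \prod_(a <- zip (take p w) (take p c)) pair_weight a (y, d)
    = \prod_(e <- take p c) pair_factor (d (+) e) ^+ (y < 0)%R.*2.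
  apply: prod_zip_snd => // z /mem_take /lt_y lt_zy e.
  exact: pair_weight_max_right.
by rewrite weight_insert prod_after prod_before [X in X * _ = _]mulrC.
Qed.

Lemma word_sum_rec n c : size c = n.+1 ->
  word_sum c = \sum_(p < n.+1)
    (\prod_(e <- drop p.+1 c) pair_factor (nth false c p (+) e))
    * (1 + (\prod_(e <- take p c) pair_factor (nth false c p (+) e)) ^+ 2)
    * word_sum (delete_at p c).
Proof.
move=> szc; rewrite /word_sum szc signed_wordsS !big_allpairs_dep.
rewrite -[X in iota _ X]subn0 -/(index_iota 0 n.+1) big_mkord.
apply: eq_bigr => p _; rewrite size_delete_at ?szc // big_cons big_seq1.
rewrite /= -big_split mulr_sumr; apply: eq_big_seq => w w_in /=.
rewrite !(weight_insert_max w_in szc) ?abszN //= !prodrXl expr0; ring.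
Qed.

Lemma prod_pair_factor_alternating d (b : bool) n :
  \prod_(e <- alternating b n) pair_factor (d (+) e)
  = (-1) ^+ n * x ^+ ((n + (d (+) b)) %/ 2).
Proof.
elim: n => [|n IH]; first by rewrite big_nil mul1r; case: (d (+) b).
rewrite alternatingS big_rcons IH addbA /=; move: (d (+) b) => e.
have -> : ((n.+1 + e) %/ 2 = (e (+) odd n) + (n + e) %/ 2)%N.
  have := odd_double_half n; case: e; case: (odd n) => /=; lia.
rewrite exprS exprD; case: (e (+) odd n) => /=; rewrite ?(expr0, expr1); ring.
Qed.

Lemma word_sum_alternating_rec (b : bool) n :
  word_sum (alternating b n.+2)
  = (-1) ^+ n.+1 * x ^+ (n.+2 %/ 2) *+ 2 * word_sum (alternating (~~ b) n.+1)
    + (1 + (x ^+ (n.+2 %/ 2)) ^+ 2) * word_sum (alternating b n.+1).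
Proof.
have inner p : (p < n)%N -> word_sum (delete_at p.+1 (alternating b n.+2)) = 0.
  move=> lt_pn; apply: (@word_sum_adjacent_eq0 _ p).
    by rewrite size_delete_at size_mkseq //= ltnS ltnW.
  exact: nth_delete_inner_alternating.
have nth_c k : (k < n.+2)%N -> nth false (alternating b n.+2) k = b (+) odd k.
  exact: nth_mkseq.
have := drop1_alternating b n.+1; have := take_alternating b n.+1.
have szc : size (alternating b n.+2) = n.+2 by rewrite size_mkseq.
move: (alternating b n.+2) => c in szc nth_c inner * => take_c drop_c.
rewrite (word_sum_rec szc) big_ord_recl big_ord_recr /=.
rewrite [X in _ + (X + _)]big1 ?add0r => [|p _]; last by rewrite inner ?mulr0.
rewrite -[bump 0 n]/n.+1 /delete_at !take0 drop_c take_c !nth_c //.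
rewrite (drop_oversize (n := n.+2)) ?szc // cats0.
rewrite !prod_pair_factor_alternating !big_nil addbF addbN addbb addn1 cat0s.
have -> : ((n.+1 + (b (+) odd n.+1 (+) b)) %/ 2 = n.+2 %/ 2)%N.
  by rewrite addbC addbA addbb; lia.
by rewrite exprMn sqrr_sign; ring.
Qed.

Lemma word_sum_alternating (b : bool) n :
  word_sum (alternating b n.+1)
  = \prod_(2 <= j < n.+2) (1 + (-1) ^+ (j - 1) * x ^+ (j %/ 2)) ^+ 2 *+ 2.
Proof.
elim: n b => [|n IH] b.
  rewrite big_geq // (@word_sum_rec 0) // big_ord1 !big_nil.
  rewrite (_ : word_sum _ = 1) ?mulr1 ?mul1r ?expr1n //.
  by rewrite /word_sum /signed_words big_seq1.
rewrite word_sum_alternating_rec !IH [in RHS]big_nat_recr //= subn1 /=.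
by rewrite [in RHS]sqrrD expr1n mul1r exprMn sqrr_sign mul1r; ring.
Qed.

Lemma sum_ascent_alternating (b : bool) n p : (2 < n)%N -> (p.+1 < n)%N ->
  (1 - x ^+ 2)
    * (\sum_(w <- signed_words n | ascent p w) weight (zip w (alternating b n)))
  = word_sum (alternating b n).
Proof.
move=> lt2n lt_pn; set c := alternating b n.
have szc : size c = n by rewrite size_mkseq.
pose j := p.+2 == n; have le_jp : (j <= p)%N by rewrite /j; case: eqP => ?; lia.
have lt_qn : ((p - j).+2 < n)%N by rewrite /j; case: eqP => ?; lia.
have [lt1 lt0] : ((p - j).+1 < n)%N /\ (p - j < n)%N by lia.
rewrite -(@sum_ascent_block3 c (p - j) j) ?szc ?subnK // !nth_mkseq //=.
  by rewrite addbN.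
by rewrite negbK.
Qed.

Lemma weight_flip_unit n w c : w \in signed_words n -> size c = n ->
  weight (zip (map flip_unit w) c) = weight (zip w c).
Proof.
move=> w_in szc; have szw := size_signed_word w_in.
apply: eq_weight; rewrite ?size_map ?szw // => i j; rewrite szc.
by move=> /andP[lt_ij lt_jn]; apply: (comparisons_nth_flip_unit w_in); lia.
Qed.

Lemma sum_even_negatives n c (P : pred (seq int)) : (0 < n)%N -> size c = n ->
    {in signed_words n, forall w, P (map flip_unit w) = P w} ->
  \sum_(w <- signed_words n | P w) weight (zip w c)
  = (\sum_(w <- signed_words n | ~~ odd (negatives w) && P w)
       weight (zip w c)) *+ 2.
Proof.
move=> n_gt0 szc P_flip.
rewrite [LHS]big_mkcond [in RHS]big_mkcondr -sumrMnl /=.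
rewrite (pair_sum_involution (uniq_signed_words n) (@flip_unit_signed_word n)
  (in1W (mapK flip_unitK)) (P := fun w => ~~ odd (negatives w))) => [|w w_in].
  rewrite big_seq_cond [RHS]big_seq_cond; apply: eq_bigr => w /andP[w_in _].
  by rewrite P_flip // (weight_flip_unit w_in) // mulr2n.
by rewrite (odd_negatives_flip_unit n_gt0).
Qed.

Lemma weight_neg_head w c : weight (zip (neg_head w) c) = weight (zip w c).
Proof.
case: w c => [|y w] [|d c] //=; congr (_ * _); apply: eq_bigr => -[z e] _.
rewrite /pair_weight /= addnC.
by congr (_ ^+ (nat_of_bool _ + nat_of_bool _)); lia.
Qed.

Lemma sum_D_ascent0 n c : (1 < n)%N ->
  \sum_(w <- signed_words n | D_ascent 0 w) weight (zip w c)
  = \sum_(w <- signed_words n | ascent 0 w) weight (zip w c).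
Proof.
move=> lt1n; rewrite (reindex_sum_involution (uniq_signed_words n)
  (@neg_head_signed_word n) (in1W neg_headK)).
rewrite big_seq_cond [RHS]big_seq_cond; apply: eq_big => [w | w _].
  apply: andb_id2l => w_in.
  by rewrite D_ascent_neg_head // (size_signed_word w_in).
exact: weight_neg_head.
Qed.

End ColoredWeights.

(** * Signed permutations as words *)

Section WordOfPerm.

Variable n : nat.
Implicit Types (s t : {perm 'I_(n.*2.+1)}) (k : 'I_(n.*2.+1)).

Definition word s : seq int := mkseq (fun j => sval_at s j.+1) n.

Lemma nth_word s (i : 'I_n) : nth 0 (word s) i = window s i.
Proof. exact: nth_mkseq. Qed.

Lemma weight_word (R : comPzRingType) (x : R) s b :
  weight x (zip (word s) (alternating b n)) = (-1) ^+ ell s * x ^+ oddlen s.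
Proof.
have expr_card (P : pred ('I_n * 'I_n)) (y : R) :
    y ^+ #|[set p | P p]| = \prod_p y ^+ P p.
  rewrite -prodr_const big_mkcond; apply: eq_bigr => p _.
  by rewrite inE; case: (P p).
rewrite weight_zip ?size_mkseq // pair_big_dep big_mkcond.
rewrite /ell /oddlen !exprD !expr_card -!big_split /=.
apply: eq_bigr => -[i j] _; rewrite !nth_word !nth_mkseq // /pair_weight /=.
have -> : (i.+1 != j.+1 %[mod 2])%N = (b (+) odd i) (+) (b (+) odd j).
  by case: b; rewrite !modn2 /=; do 2 case: odd.
case: (i < j)%N => /=; last by rewrite !expr0 !mul1r.
rewrite exprD /pair_factor; case: (window s j < window s i);
  by case: (_ + _ < 0); case: (_ (+) _); rewrite /= !(expr0, expr1); ring.
Qed.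

Lemma centered_inj : injective (@centered n).
Proof. by move=> k l /addIr [] /val_inj. Qed.

Lemma absz_centered k : (absz (centered k) <= n)%N.
Proof. by have := ltn_ord k; rewrite /centered; lia. Qed.

Lemma BgroupP s :
  reflect (forall k, s (rev_ord k) = rev_ord (s k)) (s \in Bgroup n).
Proof. by rewrite inE; apply: (iffP forallP) => sN k; apply/eqP. Qed.

Lemma sval_at0 s : s \in Bgroup n -> sval_at s 0 = 0.
Proof.
move=> /BgroupP sN; rewrite /sval_at addn0.
have mid : rev_ord (inord n : 'I_(n.*2.+1)) = inord n.
  by apply: val_inj; rewrite /= !inordK; lia.
by have := centeredN (s (inord n)); rewrite -sN mid; lia.
Qed.

Lemma absz_sval_at_inj s :
  s \in Bgroup n -> {in [pred j | j <= n]%N &, injective (absz \o sval_at s)}.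
Proof.
move=> /BgroupP sN i j; rewrite !inE => le_in le_jn /= eq_abs.
have : sval_at s i = sval_at s j \/ sval_at s i = - sval_at s j by lia.
rewrite /sval_at -centeredN -sN.
by case=> /centered_inj /perm_inj /(congr1 val); rewrite /= !inordK //; lia.
Qed.

Lemma word_signed s : s \in Bgroup n -> word s \in signed_words n.
Proof.
move=> s_in; rewrite mem_signed_words /word /mkseq -map_comp.
have abs_uniq : uniq (map (absz \o (fun j => sval_at s j.+1)) (iota 0 n)).
  rewrite map_inj_in_uniq ?iota_uniq // => i j; rewrite !mem_iota => lt_i lt_j.
  by move=> /(absz_sval_at_inj s_in lt_i lt_j)[].
have [||_ eq_abs] := uniq_min_size abs_uniq (s2 := iota 1 n).
- move=> y /mapP[j]; rewrite !mem_iota /= => lt_jn ->.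
  rewrite add1n ltnS absz_centered andbT lt0n; apply/eqP => sj0.
  have := @absz_sval_at_inj s s_in j.+1 0 lt_jn (leq0n _).
  by rewrite /= sval_at0 // sj0 => /(_ erefl).
- by rewrite size_map !size_iota.
by apply: uniq_perm; rewrite ?iota_uniq.
Qed.

Lemma word_inj : {in Bgroup n &, injective word}.
Proof.
move=> s t s_in t_in eq_word; apply/permP.
have eq_right j : (j <= n)%N -> s (inord (n + j)) = t (inord (n + j)).
  move=> le_jn; apply: centered_inj; rewrite -/(sval_at s j) -/(sval_at t j).
  case: j le_jn => [|j] lt_jn; first by rewrite !sval_at0.
  by move/(congr1 (nth 0 ^~ j)): eq_word; rewrite !nth_mkseq.
move=> k; have lt_k := ltn_ord k; have [le_nk | lt_kn] := leqP n k.
  have -> : k = inord (n + (k - n)) by rewrite subnKC // inord_val.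
  by apply: eq_right; lia.
have -> : k = rev_ord (inord (n + (n - k))).
  by apply: val_inj; rewrite /= inordK; lia.
by rewrite (BgroupP _ s_in) (BgroupP _ t_in) eq_right //; lia.
Qed.

End WordOfPerm.

Section SignedExtension.

Variables (n : nat) (w : seq int).
Hypothesis w_in : w \in signed_words n.
Implicit Type z : int.

Definition signed_extension z : int := sgz z * nth 0 w (absz z).-1.

Lemma signed_extension0 : signed_extension 0 = 0.
Proof. by rewrite /signed_extension sgz0 mul0r. Qed.

Lemma signed_extensionN z : signed_extension (- z) = - signed_extension z.
Proof. by rewrite /signed_extension abszN sgzN mulNr. Qed.

Lemma gt0_signed_extension z :
  0 < z -> signed_extension z = nth 0 w (absz z).-1.
Proof. by move=> z_gt0; rewrite /signed_extension gtr0_sgz ?mul1r. Qed.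

Lemma absz_signed_extension z :
  z != 0 -> absz (signed_extension z) = absz (nth 0 w (absz z).-1).
Proof.
by move=> z_neq0; rewrite abszM (_ : absz (sgz z) = 1%N) ?mul1n //; lia.
Qed.

Lemma signed_extension_bounds z :
  z != 0 -> (absz z <= n)%N -> (0 < absz (signed_extension z) <= n)%N.
Proof.
move=> z_neq0 le_zn; rewrite absz_signed_extension //.
apply: (signed_word_absz_bounds w_in); rewrite mem_nth //.
by rewrite (size_signed_word w_in); lia.
Qed.

Lemma signed_extension_inj :
  {in [pred z | (absz z <= n)%N] &, injective signed_extension}.
Proof.
move=> y z; rewrite !inE => le_yn le_zn eq_ext.
have [y0 | y_neq0] := eqVneq y 0; have [z0 | z_neq0] := eqVneq z 0.
- by rewrite y0 z0.
- have := signed_extension_bounds z_neq0 le_zn; rewrite -eq_ext y0.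
  by rewrite signed_extension0.
- have := signed_extension_bounds y_neq0 le_yn; rewrite eq_ext z0.
  by rewrite signed_extension0.
have eq_abs : absz y = absz z.
  have := congr1 absz eq_ext; rewrite !absz_signed_extension // => /eqP.
  by rewrite (eq_absz_nth_signed_word w_in); lia.
have [// | y_opp] : y = z \/ y = - z by lia.
have := signed_extensionN z; rewrite -y_opp eq_ext.
by have := signed_extension_bounds z_neq0 le_zn; lia.
Qed.

Lemma word_surj : exists2 s, s \in Bgroup n & word s = w.
Proof.
pose ext (k : 'I_(n.*2.+1)) : 'I_(n.*2.+1) :=
  inord (absz (signed_extension (centered k) + n%:Z)).
have centered_ext k : centered (ext k) = signed_extension (centered k).
  have le_n : (absz (signed_extension (centered k)) <= n)%N.
    have [-> | k_neq0] := eqVneq (centered k) 0.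
      by rewrite signed_extension0.
    by have /andP[] := signed_extension_bounds k_neq0 (absz_centered k).
  by rewrite {1}/centered /ext inordK; lia.
have ext_inj : injective ext.
  move=> k l /(congr1 (@centered n)); rewrite !centered_ext.
  move=> /signed_extension_inj eq_kl; apply/centered_inj/eq_kl;
    exact: absz_centered.
exists (perm ext_inj).
  apply/BgroupP => k; apply: centered_inj.
  by rewrite !permE centeredN !centered_ext centeredN signed_extensionN.
apply: (@eq_from_nth _ 0) => [|j]; rewrite size_mkseq.
  by rewrite (size_signed_word w_in).
move=> lt_jn; rewrite nth_mkseq // /sval_at permE centered_ext.
by rewrite centered_inord // gt0_signed_extension.
Qed.

End SignedExtension.

Lemma sum_Bgroup_word (V : nmodType) n (P : pred (seq int)) (F : seq int -> V) :
  \sum_(s in Bgroup n | P (word s)) F (word s)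
  = \sum_(w <- signed_words n | P w) F w.
Proof.
rewrite -big_filter_cond -(big_map (@word n) P F).
apply: perm_big; apply: uniq_perm; rewrite ?uniq_signed_words //.
  rewrite map_inj_in_uniq ?filter_uniq ?index_enum_uniq //.
  move=> s t; rewrite !mem_filter => /andP[s_in _] /andP[t_in _].
  exact: word_inj.
move=> w; apply/mapP/idP => [[s] | /word_surj[s s_in <-]].
  by rewrite mem_filter => /andP[s_in _] ->; apply: word_signed.
by exists s => //; rewrite mem_filter s_in mem_index_enum.
Qed.

Lemma mem_Dquotient1 n (i : 'I_n) (s : {perm 'I_(n.*2.+1)}) : (1 < n)%N ->
  (s \in Dquotient [set i])
  = [&& s \in Bgroup n, ~~ odd (negatives (word s)) & D_ascent i (word s)].
Proof.
move=> lt1n; rewrite !inE -!andbA; congr [&& _, ~~ odd _ & _].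
  rewrite cardE size_filter /negatives /word /mkseq -val_enum_ord -map_comp.
  by rewrite count_map -enumT; apply: eq_count => k; rewrite /= inE.
have -> : [forall j in [set i], sval_D s j < sval_D s j.+1]
    = (sval_D s i < sval_D s i.+1).
  apply/forall_inP/idP => [|asc_i j]; first by apply; rewrite inE.
  by rewrite inE => /eqP ->.
by case: i => -[|i] lt_in; rewrite /sval_D /= /ascent !nth_mkseq //; lia.
Qed.

Lemma sum_Dquotient1 (R : comPzRingType) (x : R) n (i : 'I_n) : (2 < n)%N ->
  (1 - x ^+ 2)
    * (\sum_(s in Dquotient [set i]) (-1) ^+ ell s * x ^+ oddlen s) *+ 2
  = word_sum x (alternating false n).
Proof.
move=> lt2n; have lt1n := ltnW lt2n.
under eq_bigl do rewrite mem_Dquotient1 //.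
under eq_bigr do rewrite -(weight_word _ _ false).
pose even_D_ascent w := ~~ odd (negatives w) && D_ascent i w.
rewrite (sum_Bgroup_word n even_D_ascent (fun w => weight x (zip w _))).
rewrite -mulrnAr -sum_even_negatives ?size_mkseq ?(ltnW lt1n) //; last first.
  by move=> w; apply: D_ascent_flip_unit.
case: i @even_D_ascent => -[|p] lt_pn _; last exact: sum_ascent_alternating.
by rewrite sum_D_ascent0 // sum_ascent_alternating.
Qed.

Theorem theorem5p1 (n : nat) (hn : (3 <= n)%N) (i : 'I_n) :
  \sum_(s in Dquotient [set i]) (-1) ^+ ell s * 'X ^+ oddlen s
  = (1 - 'X ^+ 2)
    * \prod_(4 <= j < n.+1) (1 + (-1) ^+ (j - 1) * 'X ^+ (j %/ 2)) ^+ 2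
  :> {poly int}.
Proof.
have two_neq0 : 2%:R != 0 :> {poly int} by rewrite -polyC_natr polyC_eq0.
have one_minus_neq0 : 1 - 'X ^+ 2 != 0 :> {poly int}.
  by rewrite -oppr_eq0 opprB -polyC1 monic_neq0 // monicXnsubC.
apply: (mulfI two_neq0); apply: (mulfI one_minus_neq0).
have := sum_Dquotient1 ('X : {poly int}) i hn.
set S := \sum_(s in _) _ => sum_S.
transitivity (word_sum ('X : {poly int}) (alternating false n)).
  by rewrite -sum_S; ring.
case: n hn {i S sum_S} => // n hn; rewrite word_sum_alternating.
by do 2![rewrite big_ltn; last by lia]; rewrite /=; ring.
Qed.
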